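(* Let $A$ be a Banach algebra, let $B$ be a Banach $A$-bimodule, let $n\ge 0$ be an even number, and let $D:A^{(n)}\to B^{(n+1)}$ be a derivation. If $\tilde Z^\ell_{A^{(n+2)}}(B^{(n+2)})=B^{(n+2)}$, then the second adjoint $D'':A^{(n+2)}\to B^{(n+3)}$ is a derivation.
   Context: For a bounded bilinear map $m:X\times Y\to Z$ of normed spaces define $m^*:Z^*\times X\to Y^*$ by $\langle m^*(z',x),y\rangle=\langle z',m(x,y)\rangle$, $m^{**}=(m^* )^*:Y^{**}\times Z^*\to X^*$ and $m^{***}=(m^{**})^*:X^{**}\times Y^{**}\to Z^{**}$. $A^{(k)},B^{(k)}$ denote the $k$-th duals, $A^{(0)}=A$, $B^{(0)}=B$. For even $k\ge2$, $A^{(k)}$ is a Banach algebra under the first Arens product, i.e. $m^{***}$ for $m$ the product of $A^{(k-2)}$, and $B^{(k)}$ is a Banach $A^{(k)}$-bimodule with left and right actions $m^{***}$ for $m$ the left and right actions of $A^{(k-2)}$ on $B^{(k-2)}$; actions are written by juxtaposition. For even $k\ge 0$, $B^{(k+1)}$ is the dual $A^{(k)}$-bimodule: $\langle ab',b\rangle=\langle b',ba\rangle$, $\langle b'a,b\rangle=\langle b',ab\rangle$ ($a\in A^{(k)}$, $b\in B^{(k)}$, $b'\in B^{(k+1)}$). A derivation from a Banach algebra $C$ to a Banach $C$-bimodule $M$ is a bounded linear map $D:C\to M$ with $D(xy)=xD(y)+D(x)y$ for all $x,y\in C$. $\tilde Z^\ell_{A^{(n+2)}}(B^{(n+2)})$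 is the set of $b\in B^{(n+2)}$ such that $a\mapsto ba$, $A^{(n+2)}\to B^{(n+2)}$, is continuous from the weak* topology $\sigma(A^{(n+2)},A^{(n+1)})$ to the weak topology $\sigma(B^{(n+2)},B^{(n+3)})$. *)

(* Defs.v *)
From HB Require Import structures.
From mathcomp Require Import all_boot all_order all_algebra.
From mathcomp Require Import all_classical all_reals topology normedtype sequences.
From mathcomp Require Import complex.
From mathcomp Require Import ring.

Set Implicit Arguments.
Unset Strict Implicit.
Unset Printing Implicit Defensive.

Import Order.TTheory GRing.Theory Num.Theory.
Import numFieldNormedType.Exports.

Local Open Scope classical_set_scope.
Local Open Scope ring_scope.

Variant scalar_kind := RealScalars | ComplexScalars.

(* R or R[i], so that real and complex Banach algebras are treated at once. *)
Definition scalar_field (R : realType) (k : scalar_kind) : numFieldType :=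
  match k with RealScalars => R | ComplexScalars => R[i]%C end.

Lemma scalar_lub (R : realType) (k : scalar_kind) (S : set (scalar_field R k)) :
  S !=set0 -> (forall x, S x -> x \is Num.real) -> has_ubound S ->
  supremums S !=set0.
Proof.
case: k S => S S0 Sreal [u Su].
  have hS : has_sup S by split=> //; exists u.
  exists (sup S); split; first exact/ub_le_sup/hS.2.
  by move=> y Sy; exact: ge_sup.
have rp (x : R[i]) : S x -> x = (complex.Re x)%:C%C.
  by move=> /Sreal xr; rewrite RRe_real.
pose T : set R := [set complex.Re x | x in S].
have T0 : T !=set0 by case: S0 => x Sx; exists (complex.Re x), x.
have Tu y : ubound S y -> ubound T (complex.Re y).
  move=> Sy _ [x Sx <-]; have := Sy _ Sx.
  by rewrite (rp _ Sx) lecE => /andP[].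
have Im0 y : ubound S y -> complex.Im y = 0.
  case: S0 => x Sx Sy; have := Sy _ Sx.
  by rewrite (rp _ Sx) lecE => /andP[/eqP].
exists (sup T)%:C%C; split.
  move=> x Sx; rewrite (rp _ Sx) lecR; apply: ub_le_sup; last by exists x.
  by exists (complex.Re u); exact: Tu.
move=> y Sy; rewrite lecE /= (Im0 _ Sy) eqxx /=.
by apply: ge_sup => //; exact: Tu.
Qed.

Lemma scalar_complete (R : realType) (k : scalar_kind)
    (F : set_system (scalar_field R k)) :
  ProperFilter F -> cauchy F -> cvg F.
Proof.
case: k F => F PF; first exact: (@R_complete R).
move=> /cauchy_ballP cF.
have ReIm (p : R[i] -> R) :
    (forall x y : R[i], `|p x - p y|%:C%C <= `|x - y|) -> cvg (p @ F).
  move=> hp; apply: R_complete; apply/cauchy_ballP => e e0.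
  have e0' : 0 < (e%:C%C : R[i]) by rewrite ltcR.
  have := cF _ e0' => -[[A B] /= [FA FB] AB].
  exists (p @` A, p @` B) => /=.
    by split; [apply: filterS FA|apply: filterS FB] => x Ax; exists x.
  move=> [_ _] /= [[x Ax <-] [y By <-]]; have := AB (x, y) (conj Ax By).
  rewrite /= -!ball_normE /ball_ /= => xy.
  by rewrite -ltcR; exact: le_lt_trans (hp x y) xy.
have hRe (x y : R[i]) : `|complex.Re x - complex.Re y|%:C%C <= `|x - y|.
  by rewrite -raddfB; exact: normc_ge_Re.
have hIm (x y : R[i]) : `|complex.Im x - complex.Im y|%:C%C <= `|x - y|.
  have hi : `|('i%C : R[i])| = 1.
    by rewrite normc_def /= expr0n expr1n add0r sqrtr1.
  rewrite -raddfB /= -normrN -ReiNIm; apply: le_trans (normc_ge_Re _) _.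
  by rewrite normrM hi mulr1.
have /cvg_ex [a Fa] := ReIm _ hRe.
have /cvg_ex [b Fb] := ReIm _ hIm.
apply/cvg_ex; exists (a +i* b)%C; apply/cvgrPdist_lt => e.
rewrite ltcE /= => /andP[/eqP ei e0].
have e2 : 0 < complex.Re e / 2 by rewrite divr_gt0.
move/cvgrPdist_lt/(_ _ e2) : Fa => Fa; move/cvgrPdist_lt/(_ _ e2) : Fb => Fb.
have ee : e = (complex.Re e)%:C%C by case: e ei {e0 e2 Fa Fb} => r i /= ->.
near=> z; rewrite ee.
have -> : (a +i* b)%C - z
    = (a - complex.Re z)%:C%C + 'i%C * (b - complex.Im z)%:C%C.
  by rewrite {1}(complexE z) {1}(complexE (a +i* b)%C) /= !rmorphB; ring.
have nr (r : R) : `|r%:C%C| = `|r|%:C%C.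
  by rewrite normc_def /= expr0n addr0 sqrtr_sqr.
apply: le_lt_trans (ler_normD _ _) _.
have hi : `|('i%C : R[i])| = 1.
  by rewrite normc_def /= expr0n expr1n add0r sqrtr1.
rewrite normrM hi mul1r !nr -rmorphD ltcR [ltRHS]splitr.
by apply: ltrD; near: z; [exact: Fa|exact: Fb].
Unshelve. all: by end_near. Qed.

Section BoundedMaps.
Context {K : numFieldType}.

Record blin (X Y : normedModType K) := Blin {
  blin_fun :> X -> Y;
  blin_linear : linear blin_fun;
  blin_bounded : exists M : K, forall x, `|blin_fun x| <= M * `|x| }.

HB.instance Definition _ (X Y : normedModType K) (f : blin X Y) :=
  GRing.isLinear.Build K X Y *:%R (blin_fun f) (blin_linear f).

Record bbilin (X Y Z : normedModType K) := Bbilin {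
  bbilin_fun :> X -> Y -> Z;
  bbilin_linearl : forall y, linear (bbilin_fun^~ y);
  bbilin_linearr : forall x, linear (bbilin_fun x);
  bbilin_bounded :
    exists M : K, forall x y, `|bbilin_fun x y| <= M * `|x| * `|y| }.

HB.instance Definition _ (X Y Z : normedModType K) (m : bbilin X Y Z) (x : X) :=
  GRing.isLinear.Build K Y Z *:%R (bbilin_fun m x) (bbilin_linearr m x).

Lemma blin_ext (X Y : normedModType K) (f g : blin X Y) : f =1 g -> f = g.
Proof.
case: f g => f fl fb [g gl gb] /= /funext fg.
by subst g; congr Blin; exact: Prop_irrelevance.
Qed.

Lemma blin_bounded_ge0 (X Y : normedModType K) (f : blin X Y) :
  exists2 M : K, 0 <= M & forall x, `|f x| <= M * `|x|.
Proof.
have [M Mf] := blin_bounded f.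
case: (pselect (exists x : X, x != 0)) => [[x x0]|nx].
  exists M => //; rewrite -(pmulr_lge0 _ (_ : 0 < `|x|)) ?normr_gt0//.
  exact: le_trans (Mf x).
exists 0 => // x; have [->|x0] := eqVneq x 0; last by case: nx; exists x.
by rewrite linear0 !normr0 mulr0.
Qed.

Lemma bbilin_bounded_ge0 (X Y Z : normedModType K) (m : bbilin X Y Z) :
  exists2 M : K, 0 <= M & forall x y, `|m x y| <= M * `|x| * `|y|.
Proof.
have [M Mm] := bbilin_bounded m.
have m0 x : m x 0 = 0 by exact: linear0.
have m0' y : m 0 y = 0.
  have := bbilin_linearl m y (-1) 0 0.
  by rewrite scaler0 addr0 scaleN1r addNr.
case: (pselect (exists xy : X * Y, xy.1 != 0 /\ xy.2 != 0)) => [[[x y]/= [x0 y0]]|nx].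
  exists M => //; rewrite -(pmulr_lge0 _ (_ : 0 < `|x| * `|y|)).
    by rewrite mulrA; exact: le_trans (Mm x y).
  by rewrite mulr_gt0// normr_gt0.
exists 0 => // x y; have [->|x0] := eqVneq x 0; first by rewrite m0' !normr0 !mulr0 mul0r.
have [->|y0] := eqVneq y 0; first by rewrite m0 !normr0 !mulr0.
by case: nx; exists (x, y).
Qed.

Lemma flip_bounded (X Y Z : normedModType K) (m : bbilin X Y Z) :
  exists M : K, forall y x, `|m x y| <= M * `|y| * `|x|.
Proof. by have [M Mm] := bbilin_bounded m; exists M => y x; rewrite mulrAC. Qed.

Definition flip (X Y Z : normedModType K) (m : bbilin X Y Z) : bbilin Y X Z :=
  @Bbilin Y X Z (fun y x => m x y)
    (bbilin_linearr m) (bbilin_linearl m) (flip_bounded m).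

End BoundedMaps.

Section Dual.
Context {R : realType} {k : scalar_kind}.
Notation K := (scalar_field R k).

Definition dual_space (X : normedModType K) : Type := blin X K^o.

Section Structure.
Variable X : normedModType K.
Implicit Types f g : dual_space X.

HB.instance Definition _ := gen_eqMixin (dual_space X).
HB.instance Definition _ := gen_choiceMixin (dual_space X).

Fact dual0_linear : linear (fun _ : X => 0 : K^o).
Proof. by move=> a x y; rewrite scaler0 addr0. Qed.
Fact dual0_bounded : exists M : K, forall x : X, `|0 : K^o| <= M * `|x|.
Proof. by exists 0 => x; rewrite normr0 mul0r. Qed.
Definition dual0 : dual_space X := Blin dual0_linear dual0_bounded.

Fact dualD_linear f g : linear (fun x : X => f x + g x : K^o).
Proof. by move=> a x y; rewrite !linearP scalerDr addrACA. Qed.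
Fact dualD_bounded f g : exists M : K, forall x : X, `|f x + g x| <= M * `|x|.
Proof.
have [M Mf] := blin_bounded f; have [N Ng] := blin_bounded g.
exists (M + N) => x; rewrite mulrDl.
by apply: le_trans (ler_normD _ _) _; exact: lerD.
Qed.
Definition dualD f g : dual_space X := Blin (dualD_linear f g) (dualD_bounded f g).

Fact dualZ_linear (a : K) f : linear (fun x : X => a *: f x : K^o).
Proof. by move=> b x y; rewrite linearP scalerDr !scalerA mulrC. Qed.
Fact dualZ_bounded (a : K) f : exists M : K, forall x : X, `|a *: f x| <= M * `|x|.
Proof.
have [M Mf] := blin_bounded f; exists (`|a| * M) => x.
by rewrite normrZ -mulrA ler_wpM2l.
Qed.
Definition dualZ a f : dual_space X := Blin (dualZ_linear a f) (dualZ_bounded a f).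

Definition dualN f : dual_space X := dualZ (-1) f.

Fact dual_addA : associative dualD.
Proof. by move=> f g h; apply: blin_ext => x /=; rewrite addrA. Qed.
Fact dual_addC : commutative dualD.
Proof. by move=> f g; apply: blin_ext => x /=; rewrite addrC. Qed.
Fact dual_add0 : left_id dual0 dualD.
Proof. by move=> f; apply: blin_ext => x /=; rewrite add0r. Qed.
Fact dual_addN : left_inverse dual0 dualN dualD.
Proof. by move=> f; apply: blin_ext => x /=; rewrite scaleN1r addNr. Qed.

HB.instance Definition _ := GRing.isZmodule.Build (dual_space X)
  dual_addA dual_addC dual_add0 dual_addN.

Fact dual_scaleA a b f : dualZ a (dualZ b f) = dualZ (a * b) f.
Proof. by apply: blin_ext => x /=; rewrite scalerA. Qed.
Fact dual_scale1 : left_id 1 dualZ.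
Proof. by move=> f; apply: blin_ext => x /=; rewrite scale1r. Qed.
Fact dual_scaleDr : right_distributive dualZ +%R.
Proof. by move=> a f g; apply: blin_ext => x /=; rewrite scalerDr. Qed.
Fact dual_scaleDl f : {morph dualZ^~ f : a b / a + b}.
Proof. by move=> a b; apply: blin_ext => x /=; rewrite scalerDl. Qed.

HB.instance Definition _ := GRing.Zmodule_isLmodule.Build K (dual_space X)
  dual_scaleA dual_scale1 dual_scaleDr dual_scaleDl.

Definition dual_norm f : K :=
  supremum 0 [set `|f x| | x in [set x : X | `|x| <= 1]].

Lemma dual_norm_sup f :
  supremums [set `|f x| | x in [set x : X | `|x| <= 1]] (dual_norm f).
Proof.
rewrite /dual_norm /supremum; case: ifPn => [/eqP S0|_].
  have : [set `|f x| | x in [set x : X | `|x| <= 1]] `|f 0|.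
    by exists 0 => //=; rewrite normr0.
  by rewrite S0.
apply: xgetPex; apply: scalar_lub.
- by exists `|f 0|; exists 0 => //=; rewrite normr0.
- by move=> _ [x _ <-]; exact: normr_real.
have [M M0 Mf] := blin_bounded_ge0 f; exists M => _ [x /= x1 <-].
by apply: le_trans (Mf x) _; rewrite ler_piMr.
Qed.

Lemma dual_norm_ge0 f : 0 <= dual_norm f.
Proof.
apply: le_trans ((dual_norm_sup f).1 `|f 0| _) => //.
by exists 0 => //=; rewrite normr0.
Qed.

Lemma dual_normP f x : `|f x| <= dual_norm f * `|x|.
Proof.
have [->|x0] := eqVneq x 0; first by rewrite linear0 !normr0 mulr0.
have nx : 0 < `|x| by rewrite normr_gt0.
rewrite -ler_pdivrMr//; apply: (dual_norm_sup f).1.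
exists (`|x|^-1 *: x) => /=; first by rewrite normfZV.
by rewrite linearZ normrZ normfV normr_id mulrC.
Qed.

Lemma dual_norm_le f (M : K) :
  0 <= M -> (forall x, `|f x| <= M * `|x|) -> dual_norm f <= M.
Proof.
move=> M0 Mf; apply: (dual_norm_sup f).2 => _ [x /= x1 <-].
by apply: le_trans (Mf x) _; rewrite ler_piMr.
Qed.

Fact dual_normD f g : dual_norm (f + g) <= dual_norm f + dual_norm g.
Proof.
apply: dual_norm_le => [|x]; first by rewrite addr_ge0 ?dual_norm_ge0.
rewrite mulrDl; apply: le_trans (ler_normD _ _) _.
by apply: lerD; exact: dual_normP.
Qed.

Fact dual_norm0_eq0 f : dual_norm f = 0 -> f = 0.
Proof.
move=> f0; apply: blin_ext => x /=; apply/eqP; rewrite -normr_le0.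
by have := dual_normP f x; rewrite f0 mul0r.
Qed.

Fact dual_normZ (a : K) f : dual_norm (a *: f) = `|a| * dual_norm f.
Proof.
have le b g : dual_norm (b *: g) <= `|b| * dual_norm g.
  apply: dual_norm_le => [|x]; first by rewrite mulr_ge0 ?dual_norm_ge0.
  by rewrite /= normrZ -mulrA ler_wpM2l// dual_normP.
apply/eqP; rewrite eq_le le /=; have [->|a0] := eqVneq a 0.
  by rewrite normr0 mul0r dual_norm_ge0.
rewrite mulrC -ler_pdivlMr ?normr_gt0// mulrC -normfV.
by apply: le_trans (le _ _); rewrite scalerA mulVf// scale1r.
Qed.

HB.instance Definition _ := Lmodule_isNormed.Build K (dual_space X)
  dual_normD dual_normZ dual_norm0_eq0.

Lemma dual_le f x : `|f x| <= `|f| * `|x|.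
Proof. exact: dual_normP. Qed.

Lemma dual_norm_le_bound f (M : K) :
  0 <= M -> (forall x, `|f x| <= M * `|x|) -> `|f| <= M.
Proof. exact: dual_norm_le. Qed.

Lemma dual_complete (F : set_system (dual_space X)) :
  ProperFilter F -> cauchy F -> cvg F.
Proof.
move=> PF /cauchy_ballP cF.
have small (e : K) : 0 < e -> exists2 A, F A & forall f g, A f -> A g ->
    forall x, `|f x - g x| <= e * `|x|.
  move=> e0; have [[A B] /= [FA FB] AB] := cF _ e0.
  exists (A `&` B); first exact: filterI.
  move=> f g [Af _] [_ Bg] x; have := AB (f, g) (conj Af Bg).
  rewrite /= -ball_normE /ball_ /= => fg.
  have -> : f x - g x = (f - g) x by rewrite /= scaleN1r.
  by apply: le_trans (dual_le (f - g) x) _; rewrite ler_wpM2r// ltW.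
have /choice[L FL] : forall x, exists l : K, (fun f : dual_space X => (f x : K)) @ F --> l.
  move=> x; apply/cvg_ex; apply: scalar_complete; apply/cauchy_ballP => e e0.
  have e0' : 0 < e / (`|x| + 1) by rewrite divr_gt0// ltr_wpDl.
  have [A FA Ae] := small _ e0'.
  pose B := (fun f : dual_space X => (f x : K)) @` A.
  exists (B, B) => /=; first by split; apply: (@filterS _ F _ A) => // f Af; exists f.
  move=> [_ _] /= [[f Af <-] [g Ag <-]]; rewrite -ball_normE /ball_ /=.
  apply: le_lt_trans (Ae _ _ Af Ag x) _.
  by rewrite mulrAC ltr_pdivrMr ?ltr_wpDl// ltr_pM2l// ltrDl.
have lim_le (e : K) : 0 < e -> exists2 A, F A & forall f, A f ->
    forall x, `|f x - L x| <= e * `|x|.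
  move=> e0; have [A FA Ae] := small _ e0; exists A => // f Af x.
  apply/ler_addgt0Pl => d d0.
  have /cvgrPdist_lt/(_ _ d0) Ld := FL x.
  have [g [Ag gd]] : exists g, A g /\ `|L x - g x| < d.
    by apply: (@filter_ex _ F); exact: filterI.
  have -> : f x - L x = (g x - L x) + (f x - g x) by ring.
  apply: le_trans (ler_normD _ _) _; apply: lerD; last exact: Ae.
  by rewrite distrC ltW.
have Llin : linear (L : X -> K^o).
  move=> a x y; apply: (cvg_unique (@norm_hausdorff _ K^o) (FL (a *: x + y))).
  have -> : (fun f : dual_space X => (f (a *: x + y) : K))
      = (fun f => a *: (f x : K^o) + (f y : K^o)).
    by apply/funext => f; exact: linearP.
  by apply: cvgD; [apply: cvgZr; exact: FL|exact: FL].
have [A1 FA1 A1L] := lim_le 1 ltr01.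
have [f1 A1f1] : exists f, A1 f by exact: (@filter_ex _ F).
have Lbd : exists M : K, forall x, `|(L x : K^o)| <= M * `|x|.
  exists (`|f1| + 1) => x; rewrite mulrDl -{1}(subrK (f1 x) (L x)) addrC.
  apply: le_trans (ler_normD _ _) _; apply: lerD; first exact: dual_le.
  by rewrite distrC; exact: A1L.
apply/cvg_ex; exists (Blin Llin Lbd : dual_space X).
apply/cvgrPdist_le => e e0; have [A FA AL] := lim_le _ e0.
apply: filterS FA => f Af; apply: dual_norm_le_bound; first exact: ltW.
by move=> x; rewrite /= scaleN1r distrC; exact: AL.
Qed.

HB.instance Definition _ := Uniform_isComplete.Build (dual_space X) dual_complete.

End Structure.

Definition dual (X : normedModType K) : completeNormedModType K := dual_space X.

Fixpoint iter_dual (X : completeNormedModType K) (j : nat) :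
    completeNormedModType K :=
  if j is i.+1 then dual (iter_dual X i) else X.

Section Adjoint.
Context {X Y : normedModType K}.
Variable f : blin X Y.

Fact adjoint_at_linear (y' : dual Y) : linear (fun x => y' (f x) : K^o).
Proof. by move=> a x1 x2; rewrite !linearP. Qed.

Fact adjoint_at_bounded (y' : dual Y) :
  exists M : K, forall x, `|y' (f x)| <= M * `|x|.
Proof.
have [M Mf] := blin_bounded f; exists (`|y'| * M) => x.
by apply: le_trans (dual_le _ _) _; rewrite -mulrA ler_wpM2l.
Qed.

Definition adjoint_at (y' : dual Y) : dual X :=
  Blin (adjoint_at_linear y') (adjoint_at_bounded y').

Fact adjoint_linear : linear adjoint_at.
Proof. by move=> a y1 y2; apply: blin_ext. Qed.

Fact adjoint_bounded : exists M : K, forall y', `|adjoint_at y'| <= M * `|y'|.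
Proof.
have [M M0 Mf] := blin_bounded_ge0 f; exists M => y'.
apply: dual_norm_le_bound => [|x]; first by rewrite mulr_ge0.
apply: le_trans (dual_le y' (f x)) _.
by rewrite (mulrC M) -mulrA ler_wpM2l// Mf.
Qed.

Definition adjoint : blin (dual Y) (dual X) :=
  Blin adjoint_linear adjoint_bounded.

End Adjoint.

Section BilinearAdjoint.
Context {X Y Z : normedModType K}.
Variable m : bbilin X Y Z.

Fact badjoint_at_linear (z' : dual Z) x : linear (fun y => z' (m x y) : K^o).
Proof. by move=> a y1 y2; rewrite !linearP. Qed.

Fact badjoint_at_bounded (z' : dual Z) x :
  exists M : K, forall y, `|z' (m x y)| <= M * `|y|.
Proof.
have [M Mm] := bbilin_bounded m; exists (`|z'| * (M * `|x|)) => y.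
by apply: le_trans (dual_le _ _) _; rewrite -mulrA ler_wpM2l.
Qed.

Definition badjoint_at (z' : dual Z) (x : X) : dual Y :=
  Blin (badjoint_at_linear z' x) (badjoint_at_bounded z' x).

Fact badjoint_linearl x : linear (badjoint_at^~ x).
Proof. by move=> a z1 z2; apply: blin_ext. Qed.

Fact badjoint_linearr z' : linear (badjoint_at z').
Proof.
by move=> a x1 x2; apply: blin_ext => y /=; rewrite bbilin_linearl linearP.
Qed.

Lemma badjoint_le (M : K) : 0 <= M ->
  (forall x y, `|m x y| <= M * `|x| * `|y|) ->
  forall z' x, `|badjoint_at z' x| <= M * `|z'| * `|x|.
Proof.
move=> M0 Mm z' x; apply: dual_norm_le_bound => [|y]; first by rewrite !mulr_ge0.
apply: le_trans (dual_le z' (m x y)) _.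
by rewrite (mulrC M) -!mulrA ler_wpM2l// mulrA Mm.
Qed.

Fact badjoint_bounded :
  exists M : K, forall z' x, `|badjoint_at z' x| <= M * `|z'| * `|x|.
Proof.
by have [M M0 Mm] := bbilin_bounded_ge0 m; exists M; exact: badjoint_le.
Qed.

(* The map m^* : Z^* x X -> Y^*, <m^*(z', x), y> = <z', m(x, y)>. *)
Definition badjoint : bbilin (dual Z) X (dual Y) :=
  Bbilin badjoint_linearl badjoint_linearr badjoint_bounded.

End BilinearAdjoint.

(* The map m^*** : X^** x Y^** -> Z^**. *)
Definition arens (X Y Z : normedModType K) (m : bbilin X Y Z) :
    bbilin (dual (dual X)) (dual (dual Y)) (dual (dual Z)) :=
  badjoint (badjoint (badjoint m)).

Lemma arens_le (X Y Z : normedModType K) (m : bbilin X Y Z) (M : K) : 0 <= M ->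
  (forall x y, `|m x y| <= M * `|x| * `|y|) ->
  forall x y, `|arens m x y| <= M * `|x| * `|y|.
Proof. by move=> M0 Mm; do 3 apply: badjoint_le => //. Qed.

Lemma arens_assoc (X Y Z U V W : normedModType K) (m1 : bbilin X Y U)
    (m2 : bbilin U Z W) (m3 : bbilin Y Z V) (m4 : bbilin X V W) :
  (forall x y z, m2 (m1 x y) z = m4 x (m3 y z)) ->
  forall x y z, arens m2 (arens m1 x y) z = arens m4 x (arens m3 y z).
Proof.
move=> m1234 F G H; apply: blin_ext => f /=.
congr (F _); apply: blin_ext => x /=.
congr (G _); apply: blin_ext => y /=.
congr (H _); apply: blin_ext => z /=.
by rewrite m1234.
Qed.

(* A Banach algebra need not have a unit. *)
Record banach_algebra (A : completeNormedModType K) := BanachAlgebra {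
  alg_mul :> bbilin A A A;
  alg_mulA : associative alg_mul;
  alg_norm_mul : forall x y, `|alg_mul x y| <= `|x| * `|y| }.

Record banach_bimodule (A : completeNormedModType K) (a : banach_algebra A)
    (B : completeNormedModType K) := BanachBimodule {
  lact : bbilin A B B;
  ract : bbilin B A B;
  lactA : forall x y b, lact (a x y) b = lact x (lact y b);
  ractA : forall b x y, ract (ract b x) y = ract b (a x y);
  lractA : forall x b y, ract (lact x b) y = lact x (ract b y) }.

Definition is_derivation (A B : completeNormedModType K) (a : banach_algebra A)
    (b : banach_bimodule a B) (D : blin A B) :=
  forall x y : A, D (a x y) = lact b x (D y) + ract b (D x) y.

Section SecondDual.
Context {A B : completeNormedModType K} (a : banach_algebra A).
Variable b : banach_bimodule a B.

Fact bidual_mulA : associative (arens a).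
Proof.
by move=> x y z; symmetry; apply: arens_assoc => {}x {}y {}z; rewrite alg_mulA.
Qed.

Fact bidual_norm_mul x y : `|arens a x y| <= `|x| * `|y|.
Proof.
rewrite -[`|x|]mul1r; apply: arens_le => // {}x {}y.
by rewrite mul1r; exact: alg_norm_mul.
Qed.

Definition bidual_algebra : banach_algebra (dual (dual A)) :=
  BanachAlgebra bidual_mulA bidual_norm_mul.

Definition bidual_bimodule : banach_bimodule bidual_algebra (dual (dual B)) :=
  @BanachBimodule (dual (dual A)) bidual_algebra (dual (dual B))
    (arens (lact b)) (arens (ract b))
    (arens_assoc (lactA b)) (arens_assoc (ractA b)) (arens_assoc (lractA b)).

(* The actions <x b', y> = <b', y x> and <b' x, y> = <b', x y>. *)
Definition dual_lact : bbilin A (dual B) (dual B) :=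
  flip (badjoint (flip (ract b))).
Definition dual_ract : bbilin (dual B) A (dual B) := badjoint (lact b).

Fact dual_lactA x y b' :
  dual_lact (a x y) b' = dual_lact x (dual_lact y b').
Proof. by apply: blin_ext => z /=; rewrite ractA. Qed.

Fact dual_ractA b' x y :
  dual_ract (dual_ract b' x) y = dual_ract b' (a x y).
Proof. by apply: blin_ext => z /=; rewrite lactA. Qed.

Fact dual_lractA x b' y :
  dual_ract (dual_lact x b') y = dual_lact x (dual_ract b' y).
Proof. by apply: blin_ext => z /=; rewrite lractA. Qed.

Definition dual_bimodule : banach_bimodule a (dual B) :=
  BanachBimodule dual_lactA dual_ractA dual_lractA.

End SecondDual.

(* The algebra A^(2i) and the A^(2i)-bimodule B^(2i). *)
Fixpoint even_dual_algebra (A : completeNormedModType K) (a : banach_algebra A)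
    (i : nat) : banach_algebra (iter_dual A i.*2) :=
  if i is j.+1 then bidual_algebra (even_dual_algebra a j) else a.

Fixpoint even_dual_bimodule (A B : completeNormedModType K)
    (a : banach_algebra A) (b : banach_bimodule a B) (i : nat) :
    banach_bimodule (even_dual_algebra a i) (iter_dual B i.*2) :=
  if i is j.+1 then bidual_bimodule (even_dual_bimodule b j) else b.

Definition induced_topology (S : choiceType) (I : Type) (h : I -> S -> K^o) :
    topologicalType :=
  sup_topology (fun i => Topological.class (initial_topology (h i))).

Definition weak_topology (X : normedModType K) : topologicalType :=
  @induced_topology X (dual X) (fun x' x => x' x).

(* sigma(X^*, X), on the carrier of X^*. *)
Definition weak_star_topology (X : normedModType K) : topologicalType :=
  @induced_topology (dual X) X (fun x x' => x' x).

(* For an algebra A and an A-bimodule B, the set of b in B^** such that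
   a |-> b a is sigma(A^**, A^* )-sigma(B^**, B^*** ) continuous. *)
Definition left_top_center (A B : completeNormedModType K)
    (a : banach_algebra A) (b : banach_bimodule a B) : set (dual (dual B)) :=
  [set y | continuous
     (fun x : weak_star_topology (dual A) =>
        (ract (bidual_bimodule b) y x : weak_topology (dual (dual B))))].

End Dual.

(* Main.v *)
Require Import Defs.
From mathcomp Require Import all_boot all_order all_algebra.
From mathcomp Require Import all_classical all_reals topology normedtype.
From mathcomp Require Import ring.

(** It suffices to treat a derivation D : A -> B^* (for n = 2i, take A^(n) and
B^(n) for A and B). Let F, G be in A^** and phi in B^**. By the definition of
the first Arens product, <D''(FG), phi> is obtained from <phi, D(xy)> by
applying G in the variable y and then F in the variable x. The product rule for
D splits <phi, D(xy)> into two terms.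

The term <phi, D(x) y> yields <D''(F) G, phi> by unfolding the definitions.

The term <phi, x D(y)> yields, after applying G, the functional
x |-> <D''(G), phi x> on A, to which F is applied; the required value is
<D''(G), phi F> = <F D''(G), phi>. So one has to let x tend to F inside
<D''(G), phi x>. This is where the hypothesis on the topological centre enters:
F |-> <D''(G), phi F> is weak* continuous, hence it is determined by its
restriction to the canonical image of A [weak_star_weak_determined].

That in turn is the weak* density of A in A^** [canonical_cvg]. As the
approximating elements may be unbounded in norm, this is linear algebra rather
than Goldstine's theorem: on finitely many elements of A^*, F agrees with the
evaluation at a point of A [bidual_interpolation]. *)

Local Open Scope classical_set_scope.

Section SecondAdjoint.
#[local] Set Implicit Arguments.
#[local] Unset Strict Implicit.
#[local] Unset Printing Implicit Defensive.
Local Open Scope ring_scope.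
Import Order.TTheory GRing.Theory Num.Theory.
Import numFieldNormedType.Exports.
Context {R : realType} {k : scalar_kind}.
Notation K := (scalar_field R k).

Section CanonicalEmbedding.
Variable X : normedModType K.

Fact canonical_at_linear (x : X) : linear (fun f : dual X => f x : K^o).
Proof. by []. Qed.

Fact canonical_at_bounded (x : X) :
  exists M : K, forall f : dual X, `|f x| <= M * `|f|.
Proof. by exists `|x| => f; rewrite mulrC; exact: dual_le. Qed.

Definition canonical (x : X) : dual (dual X) :=
  Blin (canonical_at_linear x) (canonical_at_bounded x).

(** The statement quantifies over all g that vanish on the common kernel of s,
not just over the elements of s, so that the induction closes: this class
consists of the linear combinations of s, and when h is added to s it either
does not change, or every new g becomes an old one after subtracting a multiple
of h. *)
Lemma bidual_interpolation (F : dual (dual X)) (s : seq (dual X)) :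
  exists x : X, forall g : dual X,
    (forall v, (forall f, f \in s -> f v = 0) -> g v = 0) -> F g = g x.
Proof.
elim: s => [|h s [x Fx]].
  exists 0 => g g0.
  have -> : g = 0 by apply: blin_ext => v; exact: g0.
  by rewrite !linear0.
(* If h is nonzero at some v in the common kernel of s, moving x along v
   corrects the value at h and does not affect the values on s. *)
have [[v [sv hv]]|nv] :=
    pselect (exists v, (forall f, f \in s -> f v = 0) /\ h v = 1); last first.
  exists x => g g0; apply: Fx => v sv; apply: g0 => f.
  rewrite inE => /orP[/eqP ->|]; last exact: sv.
  apply: contrapT => /eqP hv0; apply: nv; exists ((h v)^-1 *: v); split.
    by move=> f' /sv f'v; rewrite linearZ /= f'v scaler0.
  by rewrite linearZ /= -[_ *: _]/(_ * _) mulVf.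
exists (x + (F h - h x) *: v) => g g0.
have : F (g - g v *: h) = (g - g v *: h) x.
  apply: Fx => w sw.
  have : g (w - h w *: v) = 0.
    apply: g0 => f; rewrite inE => /orP[/eqP ->|fs].
      by rewrite linearB linearZ /= hv -[_ *: _]/(_ * _) mulr1 subrr.
    by rewrite linearB linearZ /= (sv f fs) (sw f fs) scaler0 subr0.
  rewrite linearB linearZ /= => /eqP; rewrite subr_eq0 => /eqP ->.
  by rewrite -![_ *: _]/(_ * _); ring.
have -> : F (g - g v *: h) = F g - g v *: F h by rewrite linearB linearZ.
have -> : (g - g v *: h) x = g x - g v *: h x by rewrite /= scaleN1r.
move/eqP; rewrite subr_eq => /eqP ->; rewrite [in RHS]linearD [in RHS]linearZ /=.
by rewrite -![_ *: _]/(_ * _); ring.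
Qed.

(** A filter on X that stands for a net tending weak* to F; as its base consists
of exact interpolation sets, every g in the dual of X is eventually constant
along it. *)
Definition interpolating (F : dual (dual X)) : set_system X :=
  filter_from [set: seq (dual X)]
    (fun s => [set x | forall g, g \in s -> g x = F g]).

#[global] Instance interpolating_filter (F : dual (dual X)) :
  ProperFilter (interpolating F).
Proof.
apply: filter_from_proper => [|s _].
  apply: filter_from_filter => [|s t _ _]; first by exists [::].
  exists (s ++ t) => // x xst.
  by split=> g gs; apply: xst; rewrite mem_cat gs ?orbT.
have [x Fx] := bidual_interpolation F s.
by exists x => g gs; rewrite Fx// => v; exact.
Qed.

Lemma interpolating_eq (F : dual (dual X)) (g : dual X) :
  \forall x \near interpolating F, g x = F g.
Proof. by exists [:: g] => // x; apply; rewrite mem_head. Qed.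

Lemma canonical_cvg (F : dual (dual X)) :
  canonical @ interpolating F --> (F : weak_star_topology (dual X)).
Proof.
apply/cvg_sup => g B [_ [[C Co <-] CF] CB].
apply: filterS (interpolating_eq F g) => x gx; apply: CB.
by rewrite /preimage /= gx.
Qed.

End CanonicalEmbedding.

(** Along the interpolating filter of F, the values of y' at T x tend to the
value at T F by continuity, and they are the values f x, which are eventually
equal to F f. *)
Lemma weak_star_weak_determined (X Y : normedModType K)
    (T : dual (dual X) -> Y) (y' : dual Y) (f : dual X) :
  continuous (T : weak_star_topology (dual X) -> weak_topology Y) ->
  (forall x, y' (T (canonical x)) = f x) ->
  forall F, y' (T F) = F f.
Proof.
move=> Tc Tf F.
have y'c : continuous (y' : weak_topology Y -> K^o).
  move=> y.
  have /cvg_sup/(_ y') yy :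
      nbhs (y : weak_topology Y) --> (y : weak_topology Y) by exact: cvg_id.
  exact: cvg_trans (cvg_app y' yy) (@initial_continuous _ _ (y' : Y -> K^o) y).
apply: (@cvg_unique K^o (@norm_hausdorff _ K^o)
  ((fun x => y' (T (canonical x))) @ interpolating F)).
  have TF : (T \o @canonical X) @ interpolating F --> (T F : weak_topology Y).
    exact: cvg_comp (@canonical_cvg _ F) (Tc F).
  exact: cvg_comp TF (y'c (T F)).
apply: cvg_near_cst; apply: filterS (interpolating_eq F f) => x <-.
exact: Tf.
Qed.

Lemma second_adjoint_derivation (A B : completeNormedModType K)
    (a : banach_algebra A) (b : banach_bimodule a B) (D : blin A (dual B)) :
  is_derivation (dual_bimodule b) D ->
  left_top_center b = [set: dual (dual B)] ->
  is_derivation (dual_bimodule (bidual_bimodule b)) (adjoint (adjoint D)).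
Proof.
move=> Dder Zb F G; apply: blin_ext => phi.
have phiZ : left_top_center b phi by rewrite Zb.
(* In the variable x, h is G applied to y |-> <phi, D(xy)>, and q is G applied to
   y |-> <phi, D(x) y>, so that h - q is the term coming from x D(y). *)
pose h : dual A := badjoint (badjoint a) G (adjoint D phi).
pose q : dual A := adjoint D (lact (bidual_bimodule b) G phi).
have hE x : h x
    = adjoint (adjoint D) G (ract (bidual_bimodule b) phi (canonical x)) + q x.
  have -> : q x = G (badjoint (badjoint (lact b)) phi (D x)) by [].
  have -> : adjoint (adjoint D) G (ract (bidual_bimodule b) phi (canonical x))
      = G (adjoint D (ract (bidual_bimodule b) phi (canonical x))) by [].
  rewrite -linearD /=; congr (G _); apply: blin_ext => y /=.
  rewrite Dder linearD; congr (phi _ + phi _); exact: blin_ext.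
have -> : adjoint (adjoint D) (bidual_algebra a F G) phi = F (h - q + q).
  by rewrite subrK.
(* The summands <F D''(G), phi> and <D''(F) G, phi> correspond to F (h - q) and
   F q; the latter two agree by computation. *)
rewrite linearD; congr (_ + _); symmetry.
apply: (@weak_star_weak_determined _ _ (ract (bidual_bimodule b) phi)
  (adjoint (adjoint D) G)); first exact: phiZ.
by move=> x; rewrite /= -[LHS](addrK (q x)) -hE /= scaleN1r.
Qed.

End SecondAdjoint.

(* The even number n is i.*2, so that n + 1 is i.*2.+1 and n + 2 is i.+1.*2. *)
Theorem mainTheorem7 (R : realType) (k : scalar_kind)
    (A B : completeNormedModType (scalar_field R k))
    (a : banach_algebra A) (b : banach_bimodule a B) (i : nat)
    (D : blin (iter_dual A i.*2) (iter_dual B i.*2.+1)) :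
  is_derivation (dual_bimodule (even_dual_bimodule b i)) D ->
  left_top_center (even_dual_bimodule b i) = [set: iter_dual B i.+1.*2] ->
  is_derivation (dual_bimodule (even_dual_bimodule b i.+1))
    (adjoint (adjoint D) : blin (iter_dual A i.+1.*2) (iter_dual B i.+1.*2.+1)).
Proof. exact: second_adjoint_derivation. Qed.
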